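(* Let $\mathfrak g=\mathfrak{sp}(N)$, $N=2n$, $i'=N+1-i$, and let $A=\sum_{i=1}^Ny_ie_{ii'}$ with $y_i\in\mathbb C$, $y_iy_{i'}=-q^{-N-2}$. Let $U_q(\mathfrak k)\subset U_q(\mathfrak g)$ be the subalgebra generated by $$X_{\alpha_i}=e_i+c_{\alpha_i}F_i,\quad i=1,\dots,n,\qquad c_{\alpha_i}=-q\frac{y_{i+1}}{y_i}\ (1\le i\le n-1),\qquad c_{\alpha_n}=-\frac{1}{y_n^2q^{2n}}.$$ Then $U_q(\mathfrak k)$ stabilizes $A$: $\pi(x)A=A\pi(x)$ for all $x\in U_q(\mathfrak k)$, where $\pi$ is the natural representation of $U_q(\mathfrak g)$ on $\mathbb C^N$.
   Context: $q\in\mathbb C$ is nonzero and not a root of unity. $U_q(\mathfrak{sp}(2n))$ has generators $e_i,f_i,q^{\pm h_i}$, $1\le i\le n$, for the simple roots $\alpha_i=\varepsilon_i-\varepsilon_{i+1}$ ($i<n$), $\alpha_n=2\varepsilon_n$, $(\varepsilon_i,\varepsilon_j)=\delta_{ij}$: $q^{h_i}e_jq^{-h_i}=q^{(\alpha_i,\alpha_j)}e_j$, $q^{h_i}f_jq^{-h_i}=q^{-(\alpha_i,\alpha_j)}f_j$, $[e_i,f_j]=\delta_{ij}\frac{q^{h_i}-q^{-h_i}}{q-q^{-1}}$ for $i<n$, $[e_n,f_j]=\delta_{nj}\frac{q^{h_n}-q^{-h_n}}{q^2-q^{-2}}$, the $q^{\pm h_i}$ commute, plus the quantum Serre relations. Notation: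 $F_i=q^{h_i}f_i$. With matrix units $e_{jk}$ (two indices), the natural representation $\pi:U_q(\mathfrak g)\to\mathrm{End}(\mathbb C^N)$ is, for $i<n$: $e_i\mapsto e_{i,i+1}-e_{(i+1)',i'}$, $f_i\mapsto e_{i+1,i}-e_{i',(i+1)'}$, $q^{h_i}\mapsto\sum_jq^{\delta_{ji}-\delta_{ji'}-\delta_{j,i+1}+\delta_{j,(i+1)'}}e_{jj}$; and $e_n\mapsto e_{n,n+1}$, $f_n\mapsto e_{n+1,n}$, $q^{h_n}\mapsto\sum_jq^{2\delta_{jn}-2\delta_{jn'}}e_{jj}$. *)

(* Defs.v *)
From HB Require Import structures.
From mathcomp Require Import all_boot all_order all_algebra.
From mathcomp Require Import finmap generic_quotient ring_quotient boolp monalg.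
From mathcomp Require Import zify.

Set Implicit Arguments.
Unset Strict Implicit.
Unset Printing Implicit Defensive.

Import GRing.Theory.
Local Open Scope ring_scope.
Local Open Scope quotient_scope.

(* Free unital associative F-algebra on the set G (words in G as monomials). *)
Notation freeAlg F G := {malg F[{fmonom G}]}.

(* Locked: unification otherwise unfolds products of generators. *)
HB.lock Definition fvar (F : fieldType) (G : choiceType) (g : G) : freeAlg F G :=
  << fmu g >>.

Section FreeAlg.
Context (F : fieldType) (G : choiceType).
Local Notation T := (freeAlg F G).

Lemma mono_scale c (a : F) (k : {fmonom G}) : c *: << a *g k >> = << c * a *g k >> :> T.
Proof. by apply/malgP => l; rewrite (mcoeffZ c << a *g k >> l) (mcoeffU k a l) (mcoeffU k (c * a) l) mulrnAr. Qed.

Lemma freeAlg_scalerAr c (x y : T) : c *: (x * y) = x * (c *: y).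
Proof.
rewrite [x]monalgE mulr_suml scaler_sumr mulr_suml; apply: eq_bigr => k _.
rewrite [y]monalgE mulr_sumr 2!scaler_sumr mulr_sumr; apply: eq_bigr => l _.
rewrite (mono_scale c _ l).
have E a b m m' : << a *g m >> * << b *g m' >> = << a * b *g mmul m m' >> :> T.
  exact: fgmulUU.
by rewrite (E _ _ k l) (E _ _ k l) (mono_scale c) mulrCA.
Qed.

(* The algebra morphism from the free algebra to matrices extending h. *)
Context (p : nat) (h : G -> 'M[F]_p).
Definition evmon (k : {fmonom G}) : 'M[F]_p := \prod_(g <- k) h g.
Definition ev (x : T) : 'M[F]_p := \sum_(k <- msupp x) x@_k *: evmon k.

Lemma evEw (d : {fset {fmonom G}}) x : fsubset (msupp x) d ->
  ev x = \sum_(k <- d) x@_k *: evmon k.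
Proof.
move=> le; rewrite /ev (big_fset_incl _ le) => //= k _ /mcoeff_outdom ->.
by rewrite scale0r.
Qed.

Lemma evU a k : ev << a *g k >> = a *: evmon k.
Proof. by rewrite (evEw msuppU_le) big_seq_fset1 mcoeffUU. Qed.

Lemma ev_linear : linear ev.
Proof.
move=> c x y; pose d := fsetU (msupp x) (fsetU (msupp y) (msupp (c *: x + y))).
rewrite !(@evEw d); first last.
- by apply/fsubsetP => k; rewrite !inE => ->; rewrite ?orbT.
- by apply/fsubsetP => k; rewrite !inE => ->; rewrite ?orbT.
- by apply/fsubsetP => k; rewrite !inE => ->; rewrite ?orbT.
rewrite scaler_sumr -big_split /=; apply: eq_bigr => k _.
by rewrite mcoeffD mcoeffZ scalerDl scalerA.
Qed.
HB.instance Definition _ := GRing.isLinear.Build F T 'M[F]_p *:%R ev ev_linear.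

Lemma evmonM k l : evmon (mmul k l) = evmon k *m evmon l.
Proof. by rewrite /evmon fmM big_cat. Qed.

Lemma ev_monoid : monoid_morphism ev.
Proof.
split=> [|x y].
  by rewrite evU scale1r /evmon fm1 big_nil.
rewrite malgME raddf_sum mulr_suml /=; apply: eq_bigr => k _.
rewrite raddf_sum mulr_sumr /=; apply: eq_bigr => l _.
by rewrite evU evmonM -[RHS]/(mulmx _ _) -scalemxAl -scalemxAr scalerA.
Qed.
HB.instance Definition _ := GRing.isMonoidMorphism.Build T 'M[F]_p ev ev_monoid.

Lemma ev_var g : ev (fvar F g) = h g.
Proof. by rewrite fvar.unlock evU scale1r /evmon fmU big_seq1. Qed.
Lemma ev0 : ev 0 = 0. Proof. exact: (raddf0 ev). Qed.
Lemma evB x y : ev (x - y) = ev x - ev y. Proof. exact: (raddfB ev). Qed.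
Lemma evZ c x : ev (c *: x) = c *: ev x. Proof. exact: linearZZ. Qed.
Lemma ev1 : ev 1 = 1. Proof. exact: (rmorph1 ev). Qed.
Lemma evM x y : ev (x * y) = ev x * ev y. Proof. exact: (rmorphM ev). Qed.
Lemma evX x m : ev (x ^+ m) = ev x ^+ m. Proof. exact: (rmorphXn ev). Qed.
Lemma evBMM x y z w : ev (x * y - z * w) = ev x * ev y - ev z * ev w.
Proof.
exact: (etrans (evB _ _) (congr2 (fun a b => a - b) (evM _ _) (evM _ _))).
Qed.
End FreeAlg.

Section Presented.
Context (F : fieldType) (G : choiceType) (rel : freeAlg F G -> Prop).
Local Notation T := (freeAlg F G).

(* Two-sided ideal generated by [rel]. *)
Inductive in_ideal : T -> Prop :=
| Ideal0 : in_ideal 0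
| IdealB x y : in_ideal x -> in_ideal y -> in_ideal (x - y)
| IdealM a r b : rel r -> in_ideal (a * r * b).

Definition ideal : {pred T} := fun x => asbool (in_ideal x).

Lemma idealP x : reflect (in_ideal x) (x \in ideal).
Proof. exact: asboolP. Qed.

Lemma ideal_zmod_closed : zmod_closed ideal.
Proof.
split=> [|x y /idealP hx /idealP hy]; apply/idealP; first exact: Ideal0.
exact: IdealB.
Qed.
HB.instance Definition _ := GRing.isZmodClosed.Build T ideal ideal_zmod_closed.

Lemma idealMl a x : x \in ideal -> a * x \in ideal.
Proof.
move=> /idealP hx; apply/idealP; elim: hx => [|x1 x2 _ h1 _ h2|b r c hr].
- by rewrite mulr0; exact: Ideal0.
- by rewrite (mulrBr a x1 x2); apply: IdealB h1 h2.
- by rewrite !mulrA; exact: IdealM.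
Qed.

Lemma idealMr a x : x \in ideal -> x * a \in ideal.
Proof.
move=> /idealP hx; apply/idealP; elim: hx => [|x1 x2 _ h1 _ h2|b r c hr].
- by rewrite mul0r; exact: Ideal0.
- by rewrite (mulrBl a x1 x2); apply: IdealB h1 h2.
- by rewrite -mulrA; exact: IdealM.
Qed.

Lemma idealZ (c : F) x : x \in ideal -> c *: x \in ideal.
Proof. by move=> hx; rewrite -[x]mul1r scalerAl; exact: idealMl. Qed.

Lemma ideal_rel r : rel r -> r \in ideal.
Proof. by move=> hr; apply/idealP; rewrite -[r]mul1r -[_ * r]mulr1; exact: IdealM. Qed.

(* The algebra presented by the generators G and the relations r = 0, [rel r]. *)
Definition presAlg : Type := Quotient.quot ideal.
HB.instance Definition _ := GRing.Zmodule.on presAlg.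
HB.instance Definition _ := EqQuotient.on presAlg.

Local Notation pi := (\pi_presAlg).

Definition pres_one : presAlg := pi 1.
Definition pres_mul (u v : presAlg) : presAlg := pi (repr u * repr v).
Definition pres_scale (c : F) (u : presAlg) : presAlg := pi (c *: repr u).

Lemma pres_eq x y : (pi x = pi y) <-> (x - y \in ideal).
Proof.
split=> [/eqP|h]; first by rewrite -(Quotient.idealrBE ideal).
by apply/eqP; rewrite -(Quotient.idealrBE ideal).
Qed.

Lemma pres_repr x : repr (pi x) - x \in ideal.
Proof. by apply/pres_eq; rewrite reprK. Qed.

Lemma pres_piD x y : pi (x + y) = pi x + pi y.
Proof. exact: Quotient.pi_add. Qed.

Lemma pres_piM x y : pi (x * y) = pres_mul (pi x) (pi y).
Proof.
apply/esym/pres_eq.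
set x' := repr _; set y' := repr _.
have -> : x' * y' - x * y = (x' - x) * y' + x * (y' - y).
  by rewrite mulrBl mulrBr addrA subrK.
by apply: rpredD; [apply: idealMr | apply: idealMl]; exact: pres_repr.
Qed.

Lemma pres_piZ c x : pi (c *: x) = pres_scale c (pi x).
Proof. by apply/esym/pres_eq; rewrite -scalerBr; apply: idealZ; exact: pres_repr. Qed.

Lemma pres_ind (P : presAlg -> Prop) : (forall x, P (pi x)) -> forall u, P u.
Proof. by move=> h u; rewrite -[u]reprK. Qed.

Lemma pres_mulA : associative pres_mul.
Proof.
elim/pres_ind => x; elim/pres_ind => y; elim/pres_ind => z.
by rewrite -!pres_piM mulrA.
Qed.
Lemma pres_mul1 : left_id pres_one pres_mul.
Proof. by elim/pres_ind => x; rewrite -pres_piM mul1r. Qed.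
Lemma pres_1mul : right_id pres_one pres_mul.
Proof. by elim/pres_ind => x; rewrite -pres_piM mulr1. Qed.
Lemma pres_mulDl : left_distributive pres_mul +%R.
Proof.
elim/pres_ind => x; elim/pres_ind => y; elim/pres_ind => z.
by rewrite -pres_piD -!pres_piM -pres_piD mulrDl.
Qed.
Lemma pres_mulDr : right_distributive pres_mul +%R.
Proof.
elim/pres_ind => x; elim/pres_ind => y; elim/pres_ind => z.
by rewrite -pres_piD -!pres_piM -pres_piD mulrDr.
Qed.
HB.instance Definition _ := GRing.Zmodule_isPzRing.Build presAlg
  pres_mulA pres_mul1 pres_1mul pres_mulDl pres_mulDr.

Lemma pres_scaleA a b u : pres_scale a (pres_scale b u) = pres_scale (a * b) u.
Proof. by elim/pres_ind: u => x; rewrite -!pres_piZ scalerA. Qed.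
Lemma pres_scale1 : left_id 1 pres_scale.
Proof. by elim/pres_ind => x; rewrite -pres_piZ scale1r. Qed.
Lemma pres_scaleDr : right_distributive pres_scale +%R.
Proof.
move=> c; elim/pres_ind => x; elim/pres_ind => y.
by rewrite -pres_piD -!pres_piZ -pres_piD scalerDr.
Qed.
Lemma pres_scaleDl u : {morph pres_scale^~ u : a b / a + b}.
Proof.
by move=> a b; elim/pres_ind: u => x; rewrite -!pres_piZ -pres_piD scalerDl. Qed.
HB.instance Definition _ := GRing.Zmodule_isLmodule.Build F presAlg
  pres_scaleA pres_scale1 pres_scaleDr pres_scaleDl.

Lemma pres_mulE (u v : presAlg) : u * v = pres_mul u v. Proof. by []. Qed.
Lemma pres_scaleE c (u : presAlg) : c *: u = pres_scale c u. Proof. by []. Qed.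

Lemma pres_scaleAl (c : F) (u v : presAlg) : c *: (u * v) = c *: u * v.
Proof.
rewrite !pres_scaleE !pres_mulE; elim/pres_ind: u => x; elim/pres_ind: v => y.
by rewrite -pres_piZ -!pres_piM -pres_piZ scalerAl.
Qed.
Lemma pres_scaleAr (c : F) (u v : presAlg) : c *: (u * v) = u * (c *: v).
Proof.
rewrite !pres_scaleE !pres_mulE; elim/pres_ind: u => x; elim/pres_ind: v => y.
by rewrite -pres_piZ -!pres_piM -pres_piZ freeAlg_scalerAr.
Qed.

Definition pgen (g : G) : presAlg := pi (fvar F g).

Section Lift.
Context (p : nat) (h : G -> 'M[F]_p).
Hypothesis hrel : forall r, rel r -> ev h r = 0.

Lemma ev_ideal x : x \in ideal -> ev h x = 0.
Proof.
move=> /idealP; elim=> [|x1 x2 _ h1 _ h2|a r b hr]; first exact: raddf0.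
  by rewrite raddfB /= h1 h2 subrr.
by rewrite !rmorphM /= (hrel hr) -[LHS]/(ev h a *m 0 *m ev h b) mulmx0 mul0mx.
Qed.

Definition plift (u : presAlg) : 'M[F]_p := ev h (repr u).

Lemma plift_pi x : plift (pi x) = ev h x.
Proof. by apply/eqP; rewrite -subr_eq0 -raddfB /= ev_ideal //; exact: pres_repr. Qed.

Lemma plift_linear : linear plift.
Proof.
move=> c; elim/pres_ind => x; elim/pres_ind => y.
by rewrite pres_scaleE -pres_piZ -pres_piD !plift_pi linearP.
Qed.
Lemma plift_monoid : monoid_morphism plift.
Proof.
split; first by rewrite plift_pi rmorph1.
elim/pres_ind => x; elim/pres_ind => y.
by rewrite pres_mulE -pres_piM !plift_pi rmorphM.
Qed.
Lemma plift_gen g : plift (pgen g) = h g.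
Proof. by rewrite plift_pi ev_var. Qed.
End Lift.
End Presented.

Lemma ix_subproof n (i : 'I_n) : (i < n.*2)%N.
Proof. have := ltn_ord i; lia. Qed.
Lemma ixS_subproof n (i : 'I_n) : (i.+1 < n.*2)%N.
Proof. have := ltn_ord i; lia. Qed.

(* Indices are 0-based: the i-th simple root (1 <= i <= n) is the ordinal i-1,
   and likewise for the N = 2n basis vectors. [ix i] and [ixS i] are the basis
   indices i and i+1, and i' = N+1-i is [rev_ord]. The last simple root is
   recognised by [i.+1 == n]. *)
Definition ix n (i : 'I_n) : 'I_n.*2 := Ordinal (ix_subproof i).
Definition ixS n (i : 'I_n) : 'I_n.*2 := Ordinal (ixS_subproof i).

Definition eps n (k : nat) : 'rV[int]_n := \row_j (j == k :> nat)%:R.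
Definition sroot n (i : 'I_n) : 'rV[int]_n :=
  if i.+1 == n then eps n i *+ 2 else eps n i - eps n i.+1.
Definition rform n (u v : 'rV[int]_n) : int := (u *m v^T) 0 0.
Definition cartan n (i j : 'I_n) : int :=
  (2 * rform (sroot i) (sroot j) %/ rform (sroot i) (sroot i))%Z.

(* Generators e_i, f_i, q^{h_i} and q^{-h_i}. *)
Inductive Uq_gen (n : nat) : Type :=
| Ge of 'I_n | Gf of 'I_n | Gk of 'I_n | GkV of 'I_n.

Definition gen_enc n (g : Uq_gen n) : ('I_n + 'I_n) + ('I_n + 'I_n) :=
  match g with
  | Ge i => inl (inl i) | Gf i => inl (inr i)
  | Gk i => inr (inl i) | GkV i => inr (inr i)
  end.
Definition gen_dec n (s : ('I_n + 'I_n) + ('I_n + 'I_n)) : Uq_gen n :=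
  match s with
  | inl (inl i) => Ge i | inl (inr i) => Gf i
  | inr (inl i) => Gk i | inr (inr i) => GkV i
  end.
Lemma gen_encK n : cancel (@gen_enc n) (@gen_dec n).
Proof. by case. Qed.
HB.instance Definition _ n := Choice.copy (Uq_gen n) (can_type (@gen_encK n)).

Lemma mxmulE (F : fieldType) p (A B : 'M[F]_p) : A * B = A *m B.
Proof. by []. Qed.

Section Uq.
Context (F : fieldType) (n : nat) (q : F).

(* q_i = q^{(alpha_i, alpha_i)/2}. *)
Definition qd (i : 'I_n) : F := if i.+1 == n then q ^+ 2 else q.

(* Symmetric Gaussian integers, [m]_v = (v^m - v^-m) / (v - v^-1). *)
Definition qint (v : F) (m : nat) : F := (v ^+ m - v ^- m) / (v - v^-1).
Definition qfact (v : F) (m : nat) : F := \prod_(1 <= k < m.+1) qint v k.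
Definition qbinom (v : F) (m k : nat) : F :=
  qfact v m / (qfact v k * qfact v (m - k)).

Local Notation T := (freeAlg F (Uq_gen n)).
Local Notation e i := (fvar F (Ge i) : T).
Local Notation f i := (fvar F (Gf i) : T).
Local Notation k i := (fvar F (Gk i) : T).
Local Notation kV i := (fvar F (GkV i) : T).

(* sum_s (-1)^s [1 - a_ij choose s]_{q_i} x^(1 - a_ij - s) y x^s; for i != j
   the integer 1 - a_ij is positive, so [absz] only changes its type. *)
Definition serre (i j : 'I_n) (x y : T) : T :=
  let m := absz (1 - cartan i j) in
  \sum_(s < m.+1) ((-1) ^+ s * qbinom (qd i) m s) *: (x ^+ (m - s) * y * x ^+ s).

(* The relations q^{h_i} x q^{-h_i} = q^{+-(alpha_i, alpha_j)} x are written with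
   the generator q^{-h_i}, which is inverse to q^{h_i} by the first two. *)
Inductive Uq_rel : T -> Prop :=
| RkkV i : Uq_rel (k i * kV i - 1)
| RkVk i : Uq_rel (kV i * k i - 1)
| Rkk i j : Uq_rel (k i * k j - k j * k i)
| Rke i j :
    Uq_rel (k i * e j * kV i - q ^ rform (sroot i) (sroot j) *: e j)
| Rkf i j :
    Uq_rel (k i * f j * kV i - q ^ (- rform (sroot i) (sroot j)) *: f j)
| Ref i j :
    Uq_rel (e i * f j - f j * e i -
            (i == j)%:R *: ((qd i - (qd i)^-1)^-1 *: (k i - kV i)))
| RSe i j : i != j -> Uq_rel (serre i j (e i) (e j))
| RSf i j : i != j -> Uq_rel (serre i j (f i) (f j)).

Section Check.
Context (p : nat) (h : Uq_gen n -> 'M[F]_p).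
Local Notation E i := (h (Ge i)).
Local Notation H i := (h (Gf i)).
Local Notation K i := (h (Gk i)).
Local Notation KV i := (h (GkV i)).
Hypothesis hkV : forall i, K i *m KV i = 1%:M.
Hypothesis hVk : forall i, KV i *m K i = 1%:M.
Hypothesis hkk : forall i j, K i *m K j = K j *m K i.
Hypothesis hke : forall i j, K i *m E j *m KV i = q ^ rform (sroot i) (sroot j) *: E j.
Hypothesis hkf : forall i j, K i *m H j *m KV i = q ^ (- rform (sroot i) (sroot j)) *: H j.
Hypothesis hef : forall i j, E i *m H j - H j *m E i =
  (i == j)%:R *: ((qd i - (qd i)^-1)^-1 *: (K i - KV i)).
Hypothesis hse : forall i j a b, i != j -> (a + b)%N = absz (1 - cartan i j) ->
  E i ^+ a * E j * E i ^+ b = 0.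
Hypothesis hsf : forall i j a b, i != j -> (a + b)%N = absz (1 - cartan i j) ->
  H i ^+ a * H j * H i ^+ b = 0.

Lemma Uq_rel_ok r : Uq_rel r -> ev h r = 0.
Proof.
case=> [i|i|i j|i j|i j|i j|i j ij|i j ij].
- by rewrite evB evM ev1 2!ev_var mxmulE hkV subrr.
- by rewrite evB evM ev1 2!ev_var mxmulE hVk subrr.
- by rewrite evBMM 2!ev_var 2!mxmulE hkk subrr.
- by rewrite evB evZ 2!evM 3!ev_var 2!mxmulE hke subrr.
- by rewrite evB evZ 2!evM 3!ev_var 2!mxmulE hkf subrr.
- by rewrite evB evBMM 2!evZ evB 4!ev_var 2!mxmulE hef subrr.
- rewrite raddf_sum big1 // => s _; rewrite /= evZ 2!evM 2!evX 2!ev_var.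
  by rewrite hse ?scaler0 // subnK // -ltnS.
- rewrite raddf_sum big1 // => s _; rewrite /= evZ 2!evM 2!evX 2!ev_var.
  by rewrite hsf ?scaler0 // subnK // -ltnS.
Qed.
End Check.

Definition Uq : Type := presAlg Uq_rel.
HB.instance Definition _ := GRing.PzRing.on Uq.
HB.instance Definition _ := GRing.Lmodule.on Uq.

(* The counit, which shows that 1 != 0 in U_q. *)
Definition counit (g : Uq_gen n) : 'M[F]_1 :=
  match g with Ge _ | Gf _ => 0 | Gk _ | GkV _ => 1%:M end.

Lemma counit_ok r : Uq_rel r -> ev counit r = 0.
Proof.
apply: Uq_rel_ok => [i|i|i j|i j|i j|i j|i j a b _ _|i j a b _ _] /=;
  rewrite ?mulmx1 ?mulmx0 ?scaler0 ?mulr0 ?mul0r //.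
by rewrite !subrr !scaler0.
Qed.

Lemma Uq_1neq0 : (1 : Uq) != 0.
Proof.
apply/eqP => h.
have [h1 _] := plift_monoid counit_ok.
have h0 : plift counit (0 : Uq) = 0.
  by rewrite -[0 : Uq](subrr (1 : Uq)) -[X in _ - X]scale1r -scaleNr addrC
             (plift_linear counit_ok) h1 scaleN1r addNr.
have := oner_neq0 F.
suff -> : 1 = 0 :> F by rewrite eqxx.
have := congr1 (fun M : 'M[F]_1 => M 0 0) (etrans (esym h1) (etrans (congr1 _ h) h0)).
by rewrite !mxE.
Qed.
HB.instance Definition _ := GRing.PzSemiRing_isNonZero.Build Uq Uq_1neq0.
HB.instance Definition _ :=
  GRing.Lmodule_isLalgebra.Build F Uq (@pres_scaleAl _ _ Uq_rel).
HB.instance Definition _ :=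
  GRing.Lalgebra_isAlgebra.Build F Uq (@pres_scaleAr _ _ Uq_rel).

Definition Ue i : Uq := pgen Uq_rel (Ge i).
Definition Uf i : Uq := pgen Uq_rel (Gf i).
Definition Uk i : Uq := pgen Uq_rel (Gk i).
Definition UkV i : Uq := pgen Uq_rel (GkV i).
End Uq.

Section NatRep.
Context (F : fieldType) (n : nat) (q : F).

(* q^{h_i} acts on the j-th basis vector by q ^ [wt i j]. *)
Definition wt (i : 'I_n) (j : 'I_n.*2) : int :=
  if i.+1 == n then 2 * (j == ix i)%:Z - 2 * (j == rev_ord (ix i))%:Z
  else (j == ix i)%:Z - (j == rev_ord (ix i))%:Z
       - (j == ixS i)%:Z + (j == rev_ord (ixS i))%:Z.

(* Images of the generators in the natural representation. *)
Definition natgen (g : Uq_gen n) : 'M[F]_n.*2 :=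
  match g with
  | Ge i => if i.+1 == n then delta_mx (ix i) (ixS i)
            else delta_mx (ix i) (ixS i)
                 - delta_mx (rev_ord (ixS i)) (rev_ord (ix i))
  | Gf i => if i.+1 == n then delta_mx (ixS i) (ix i)
            else delta_mx (ixS i) (ix i)
                 - delta_mx (rev_ord (ix i)) (rev_ord (ixS i))
  | Gk i => diag_mx (\row_j q ^ wt i j)
  | GkV i => diag_mx (\row_j q ^ (- wt i j))
  end.

Local Notation N := n.*2.

(* coefficient of natgen (Ge i) at position (r, r + 1) *)
Definition ecoef (i r : nat) : F :=
  if (r == i)%N then 1 else if (r + i.+2 == N)%N then -1 else 0.

Lemma natgen_e i r c : natgen (Ge i) r c = ecoef i r *+ (c == r.+1 :> nat).
Proof.
have := ltn_ord i; have := ltn_ord r; have := ltn_ord c; rewrite /ecoef /=.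
move=> hc hr hi; case: ifP => hn; rewrite !mxE -!val_eqE /=.
- case: eqP => [e1|e1]; case: (c =P i.+1 :> nat) => [e2|e2] /=.
  + by rewrite e1 e2 eqxx.
  + by rewrite e1; case: eqP => // e3; lia.
  + case: (c =P r.+1 :> nat) => e3; last by rewrite mulr0n.
    by lia.
  + by case: (r + i.+2 =P n.*2)%N => e4; case: (c =P r.+1 :> nat) => e3;
      rewrite ?mul0rn ?mulr0n //; lia.
- case: eqP => [e1|e1]; case: (c =P i.+1 :> nat) => [e2|e2] /=;
  case: (r =P n.*2 - i.+2 :> nat)%N => [e3|e3];
  case: (c =P n.*2 - i.+1 :> nat)%N => [e4|e4] /=;
  case: (r + i.+2 =P n.*2)%N => [e5|e5]; case: (c =P r.+1 :> nat) => [e6|e6];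
  rewrite ?mulr0n ?mul0rn ?subr0 ?sub0r ?mulr1n //=; lia.
Qed.

Lemma natgen_f i : natgen (Gf i) = (natgen (Ge i))^T.
Proof. by rewrite /=; case: ifP => _; rewrite ?raddfB /= !trmx_delta. Qed.

Lemma ecoef_max i (r : 'I_N) : (i < n)%N -> ecoef i r != 0 -> (r.+1 < N)%N.
Proof.
rewrite /ecoef => hi; have hr := ltn_ord r.
case: (r =P i :> nat) => [e1 _|e1]; first by lia.
by case: (r + i.+2 =P N)%N => [e2 _|e2]; [lia | rewrite eqxx].
Qed.

Lemma EEt (i j : 'I_n) (r c : 'I_N) :
  (natgen (Ge i) *m (natgen (Ge j))^T) r c =
  (ecoef i r * ecoef j r) *+ (r == c).
Proof.
rewrite mxE; have [h0|hi] := eqVneq (ecoef i r) 0.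
  rewrite h0 mul0r mul0rn big1 // => s _.
  by rewrite natgen_e h0 mul0rn mul0r.
have hr := ecoef_max (ltn_ord i) hi.
rewrite (bigD1 (Ordinal hr)) //= big1 => [|s hs]; last first.
  rewrite natgen_e; case: eqP => e1; last by rewrite mulr0n mul0r.
  by case/eqP: hs; apply: val_inj.
rewrite addr0 mxE !natgen_e /= eqxx mulr1n eqSS -val_eqE /=.
by case: eqP => [->|_]; rewrite ?mulr1n ?mulr0n ?mulr0.
Qed.

Lemma EtE (i j : 'I_n) (r c : 'I_N) :
  ((natgen (Ge j))^T *m natgen (Ge i)) r c =
  (if nat_of_ord r is r'.+1 then ecoef i r' * ecoef j r' else 0) *+ (r == c).
Proof.
rewrite mxE; case: r => [[|r] hr] /=.
  by rewrite mul0rn big1 // => s _; rewrite mxE natgen_e mulr0n mul0r.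
have hr' : (r < N)%N by lia.
rewrite (bigD1 (Ordinal hr')) //= big1 => [|s hs]; last first.
  rewrite mxE natgen_e /= eqSS; case: eqP => e1; last by rewrite mulr0n mul0r.
  by case/eqP: hs; apply: val_inj.
rewrite addr0 mxE !natgen_e /= eqxx mulr1n -val_eqE /= eq_sym.
by case: eqP => [_|_]; rewrite ?mulr1n ?mulr0n ?mulr0 // mulrC.
Qed.

Hypothesis (q0 : q != 0).
Hypothesis (qroot : forall m, (0 < m)%N -> ~~ m.-unity_root q).

Lemma qX_neq1 m : (0 < m)%N -> q ^+ m != 1.
Proof. by move=> /qroot; rewrite unity_rootE. Qed.

Lemma qBV_neq0 m : (0 < m)%N -> q ^+ m - (q ^+ m)^-1 != 0.
Proof.
move=> hm; apply/negP; rewrite subr_eq0 => /eqP h.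
have /eqP[] : q ^+ (m + m) != 1 by apply: qX_neq1; lia.
by rewrite exprD {1}h mulVf // expf_neq0.
Qed.

Lemma sroot_mx (i : 'I_n) (j : 'I_n) : sroot i 0 j =
  if i.+1 == n then (j == i)%:Z * 2 else (j == i)%:Z - (j == i.+1 :> nat)%:Z.
Proof.
rewrite /sroot; case: ifP => _; rewrite !mxE -val_eqE /=.
  by case: (_ == _).
by case: (_ == _); case: (_ == _).
Qed.

Lemma rform_rootE (i : 'I_n) (u : 'rV[int]_n) : rform u (sroot i) =
  if i.+1 == n then u 0 i * 2
  else u 0 i - (if insub i.+1 is Some j then u 0 j else 0).
Proof.
rewrite /rform mxE (bigD1 i) //= mxE sroot_mx eqxx.
case: ifP => hn.
  rewrite big1 ?addr0 // => j ji; rewrite mxE sroot_mx hn (negPf ji) mul0r mulr0 //.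
have hi : (i.+1 < n)%N by have := ltn_ord i; lia.
rewrite insubT (bigD1 (Ordinal hi)) /=; last by rewrite -val_eqE /=; lia.
rewrite big1 => [|j /andP[ji js]]; last first.
  rewrite mxE sroot_mx hn (negPf ji) /=; case: eqP => e1; last by rewrite subrr mulr0.
  by case/eqP: js; apply: val_inj.
rewrite mxE sroot_mx hn -val_eqE /= eqxx.
have -> : (i == i.+1 :> nat) = false by lia.
have -> : (i.+1 == i)%N = false by lia.
by rewrite subr0 mulr1 addr0 sub0r mulrN1.
Qed.

(* (alpha_i, alpha_j) in closed form. *)
Definition ipn (i j : nat) : int :=
  if (i.+1 == n) then (if (j == i)%N then 4 else if (j.+1 == i)%N then - 2 else 0)
  else (if (j == i)%N then 2 else if (j.+1 == i)%N then -1 else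
        if (i.+1 == j)%N then (if j.+1 == n then -2 else -1) else 0).

Lemma rformE (i j : 'I_n) : rform (sroot i) (sroot j) = ipn i j.
Proof.
have hi := ltn_ord i; have hj := ltn_ord j.
rewrite rform_rootE sroot_mx -val_eqE /= /ipn.
case: (j.+1 =P n) => ej; case: (i.+1 =P n) => ei; last first.
- have hj1 : (j.+1 < n)%N by lia.
  rewrite insubT sroot_mx -val_eqE /= -[i.+1 == n]/(_ == _).
  case: (i.+1 =P n) => ei'; try lia.
  case: (j =P i :> nat) => ?; case: (j =P i.+1 :> nat) => ?;
  case: (j.+1 =P i :> nat) => ?; case: (j.+1 =P i.+1 :> nat) => ?;
  case: (i.+1 =P j :> nat) => ?; try lia; by [].
- have hj1 : (j.+1 < n)%N by lia.
  rewrite insubT sroot_mx -val_eqE /=.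
  case: (i.+1 =P n) => ei'; try lia.
  case: (j =P i :> nat) => ?; case: (j.+1 =P i :> nat) => ?; try lia; by [].
- case: (j =P i :> nat) => ?; case: (j =P i.+1 :> nat) => ?;
  case: (j.+1 =P i :> nat) => ?; case: (i.+1 =P j :> nat) => ?; try lia; by [].
- case: (j =P i :> nat) => ?; case: (j.+1 =P i :> nat) => ?; try lia; by [].
Qed.

Definition wtn (i r : nat) : int :=
  if i.+1 == n then 2 * (r == i)%:Z - 2 * (r + i.+1 == N)%N%:Z
  else (r == i)%:Z - (r + i.+1 == N)%N%:Z
       - (r == i.+1)%:Z + (r + i.+2 == N)%N%:Z.

Lemma wtE i r : wt i r = wtn i r.
Proof.
have hi := ltn_ord i; have hr := ltn_ord r.
rewrite /wt /wtn -!val_eqE /=.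
have -> : (r == n.*2 - i.+1 :> nat)%N = (r + i.+1 == n.*2)%N by lia.
by have -> : (r == n.*2 - i.+2 :> nat)%N = (r + i.+2 == n.*2)%N by lia.
Qed.

Lemma wtn_step (i j : 'I_n) (r : nat) : ecoef j r != 0 ->
  wtn i r - wtn i r.+1 = ipn i j.
Proof.
have hi := ltn_ord i; have hj := ltn_ord j.
rewrite /ecoef => h.
have {h} : r = j \/ (r + j.+2 = N)%N.
  move: h; case: (r =P j :> nat) => [?|_]; first by left.
  by case: (r + j.+2 =P N)%N => [?|_]; [right | rewrite eqxx].
rewrite /wtn /ipn.
case: (i.+1 =P n) => ei; case: (j =P i :> nat) => e1; try lia;
  case: (j.+1 =P i :> nat) => e2; try lia;
  case: (i.+1 =P j :> nat) => e3; try lia;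
  case: (j.+1 =P n) => ej; lia.
Qed.

Local Notation E i := (natgen (Ge i)).
Local Notation H i := (natgen (Gf i)).
Local Notation K i := (natgen (Gk i)).
Local Notation KV i := (natgen (GkV i)).

Lemma nat_kV i : K i *m KV i = 1%:M.
Proof.
apply/matrixP => r c; rewrite mul_diag_mx !mxE.
by case: eqP => [->|_]; rewrite ?mulr1n ?mulr0n ?mulr0 // -expfzDr // subrr.
Qed.

Lemma nat_Vk i : KV i *m K i = 1%:M.
Proof.
apply/matrixP => r c; rewrite mul_diag_mx !mxE.
by case: eqP => [->|_]; rewrite ?mulr1n ?mulr0n ?mulr0 // -expfzDr // addNr.
Qed.

Lemma nat_kk i j : K i *m K j = K j *m K i.
Proof. by rewrite /= diag_mxC. Qed.

Lemma nat_ke i j :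
  K i *m E j *m KV i = q ^ rform (sroot i) (sroot j) *: E j.
Proof.
apply/matrixP => r c.
rewrite [natgen (GkV i)]/= mul_mx_diag mxE [natgen (Gk i)]/= mul_diag_mx mxE.
rewrite !mxE natgen_e rformE !wtE.
have [->|h] := eqVneq (ecoef j r) 0; first by rewrite mul0rn !mulr0 mul0r.
case: eqP => [->|_]; last by rewrite mulr0n !mulr0 mul0r.
by rewrite mulr1n mulrAC -expfzDr // (wtn_step i h).
Qed.

Lemma nat_kf i j :
  K i *m H j *m KV i = q ^ (- rform (sroot i) (sroot j)) *: H j.
Proof.
apply/matrixP => r c; rewrite natgen_f.
rewrite [natgen (GkV i)]/= mul_mx_diag mxE [natgen (Gk i)]/= mul_diag_mx mxE.
rewrite ![(\row_j _) _ _]mxE mxE [in RHS]mxE [in RHS]mxE natgen_e rformE !wtE.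
have [->|h] := eqVneq (ecoef j c) 0; first by rewrite mul0rn !mulr0 mul0r.
case: eqP => [->|_]; last by rewrite mulr0n !mulr0 mul0r.
rewrite mulr1n mulrAC -expfzDr //; congr (q ^ _ * _).
by rewrite -(wtn_step i h) opprB.
Qed.

Lemma nat_ef i j : E i *m H j - H j *m E i =
  (i == j)%:R *: ((qd q i - (qd q i)^-1)^-1 *: (K i - KV i)).
Proof.
apply/matrixP => r c; rewrite natgen_f.
rewrite mxE [X in _ + X]mxE EEt EtE !mxE.
have hi := ltn_ord i; have hj := ltn_ord j; have hr := ltn_ord r.
case: (r =P c) => [_|_]; last first.
  by rewrite !mulr0n !subr0 !mulr0.
rewrite !mulr1n !wtE; case: eqP => [<-|ij].
  rewrite mul1r.
  have qdE : qd q i = q ^+ (if i.+1 == n then 2 else 1) by rewrite /qd; case: ifP.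
  have d0 : qd q i - (qd q i)^-1 != 0 by rewrite qdE; apply: qBV_neq0; case: ifP.
  have e2 s : ecoef i s * ecoef i s = ((s == i) || (s + i.+2 == N))%N%:R.
    rewrite /ecoef; case: (s =P i :> nat) => _; first by rewrite mulr1.
    by case: eqP => _; rewrite ?mulr0 ?mulrNN ?mulr1.
  have -> : (if nat_of_ord r is r'.+1 then ecoef i r' * ecoef i r' else 0) =
     ((r == i.+1 :> nat) || (r + i.+1 == N))%N%:R.
    case: (nat_of_ord r) => [|s]; last by rewrite e2 eqSS addSn -addnS.
    by have -> : (0 + i.+1 == N)%N = false by lia.
  rewrite e2; apply: (mulfI d0); rewrite mulrA divff // mul1r.
  rewrite /wtn qdE; case: (i.+1 =P n) => hn.
    have -> : (r == i.+1 :> nat) = (r + i.+1 == N)%N by lia.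
    have -> : (r + i.+2 == N)%N = (r == i :> nat) by lia.
    rewrite !orbb.
    case: (r =P i :> nat) => ?; case: (r + i.+1 =P N)%N => ?; try lia.
    + by rewrite subr0 mulr1.
    + by rewrite !sub0r opprK mulrN1 opprB.
    + by rewrite subrr mulr0 subrr.
  case: (r =P i :> nat) => ?; case: (r + i.+1 =P N)%N => ?; try lia;
  case: (r =P i.+1 :> nat) => ?; case: (r + i.+2 =P N)%N => ?; try lia;
  rewrite /= ?subr0 ?sub0r ?mulr1 ?addr0 ?add0r ?opprK ?oppr0 ?mulr0 ?subrr //.
  all: try by rewrite ?mulrN1 ?opprB.
rewrite mul0r; suff e0 s : ecoef i s * ecoef j s = 0.
  by rewrite e0; case: (nat_of_ord r) => [|s]; rewrite ?e0 subrr.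
have ijn : (i != j :> nat) by apply/eqP => h; apply: ij; apply: val_inj.
rewrite /ecoef; case: (s =P i :> nat) => ?; case: (s =P j :> nat) => ?;
  case: (s + i.+2 =P N)%N => ?; case: (s + j.+2 =P N)%N => ?;
  rewrite ?mulr0 ?mul0r //; lia.
Qed.

Lemma EE i j (r c : 'I_N) :
  (E i *m E j) r c = (ecoef i r * ecoef j r.+1) *+ (c == r.+2 :> nat).
Proof.
rewrite mxE; have [h0|hi] := eqVneq (ecoef i r) 0.
  rewrite h0 mul0r mul0rn big1 // => s _.
  by rewrite natgen_e h0 mul0rn mul0r.
have hr := ecoef_max (ltn_ord i) hi.
rewrite (bigD1 (Ordinal hr)) //= big1 => [|s hs]; last first.
  rewrite natgen_e; case: eqP => e1; last by rewrite mulr0n mul0r.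
  by case/eqP: hs; apply: val_inj.
by rewrite addr0 !natgen_e /= eqxx mulr1n mulrnAr.
Qed.

Lemma EEE i j (r c : 'I_N) :
  (E i *m (E j *m E i)) r c =
  (ecoef i r * (ecoef j r.+1 * ecoef i r.+2)) *+ (c == r.+3 :> nat).
Proof.
rewrite mxE; have [h0|hi] := eqVneq (ecoef i r) 0.
  rewrite h0 mul0r mul0rn big1 // => s _.
  by rewrite natgen_e h0 mul0rn mul0r.
have hr := ecoef_max (ltn_ord i) hi.
rewrite (bigD1 (Ordinal hr)) //= big1 => [|s hs]; last first.
  rewrite natgen_e; case: eqP => e1; last by rewrite mulr0n mul0r.
  by case/eqP: hs; apply: val_inj.
by rewrite addr0 natgen_e EE /= eqxx mulr1n mulrnAr.
Qed.

Lemma ecoef_neq0 i r : ecoef i r != 0 -> r = i \/ (r + i.+2 = N)%N.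
Proof.
rewrite /ecoef; case: (r =P i :> nat) => [?|_]; first by left.
by case: (r + i.+2 =P N)%N => [?|_]; [right | rewrite eqxx].
Qed.

Lemma E2_0 i : E i *m E i = 0.
Proof.
have hi := ltn_ord i.
apply/matrixP => r c; rewrite EE [RHS]mxE.
have [->|/ecoef_neq0 h1] := eqVneq (ecoef i r) 0; first by rewrite mul0r mul0rn.
have [->|/ecoef_neq0 h2] := eqVneq (ecoef i r.+1) 0; first by rewrite mulr0 mul0rn.
lia.
Qed.

(* 1 - a_ij for i != j. *)
Definition sexp (i j : nat) : nat :=
  if (j.+1 == i)%N then 2
  else if (i.+1 == j)%N then (if j.+1 == n then 3 else 2) else 1.

Lemma sexpE (i j : 'I_n) : i != j -> absz (1 - cartan i j) = sexp i j.
Proof.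
have hi := ltn_ord i; have hj := ltn_ord j.
rewrite -val_eqE /cartan !rformE /ipn /sexp /= eqxx => ij.
case: (j =P i :> nat) => [?|_]; first lia.
case: (i.+1 =P n) => ?; case: (j.+1 =P i :> nat) => ?;
  case: (i.+1 =P j :> nat) => ?; case: (j.+1 =P n) => ?; try lia; by [].
Qed.

Lemma nat_se i j a b : i != j -> (a + b)%N = absz (1 - cartan i j) ->
  E i ^+ a * E j * E i ^+ b = 0.
Proof.
move=> ij; rewrite sexpE //.
have hi := ltn_ord i; have hj := ltn_ord j.
have ij' : (i != j :> nat) by rewrite val_eqE.
have e2 : E i * E i = 0 by exact: E2_0.
have pow0 m : E i ^+ m.+2 = 0 by rewrite 2!exprS mulrA e2 mul0r.
case: a b => [|[|a]] [|[|b]]; rewrite ?pow0 ?mulr0 ?mul0r //.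
- by rewrite /sexp; do !case: ifP.
- rewrite expr0 expr1 mul1r mxmulE /sexp.
  case: (j.+1 =P i :> nat) => // ?; case: (i.+1 =P j :> nat) => ?.
    by case: ifP.
  move=> _; apply/matrixP => r c; rewrite EE [RHS]mxE.
  have [->|/ecoef_neq0 h1] := eqVneq (ecoef j r) 0; first by rewrite mul0r mul0rn.
  have [->|/ecoef_neq0 h2] := eqVneq (ecoef i r.+1) 0; first by rewrite mulr0 mul0rn.
  lia.
- rewrite expr0 expr1 mulr1 mxmulE /sexp.
  case: (j.+1 =P i :> nat) => // ?; case: (i.+1 =P j :> nat) => ?.
    by case: ifP.
  move=> _; apply/matrixP => r c; rewrite EE [RHS]mxE.
  have [->|/ecoef_neq0 h1] := eqVneq (ecoef i r) 0; first by rewrite mul0r mul0rn.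
  have [->|/ecoef_neq0 h2] := eqVneq (ecoef j r.+1) 0; first by rewrite mulr0 mul0rn.
  lia.
- rewrite expr1 -mulrA 2!mxmulE => hs.
  apply/matrixP => r c; rewrite EEE [RHS]mxE.
  have [->|/ecoef_neq0 h1] := eqVneq (ecoef i r) 0; first by rewrite mul0r mul0rn.
  have [->|/ecoef_neq0 h2] := eqVneq (ecoef j r.+1) 0.
    by rewrite mul0r mulr0 mul0rn.
  have [->|/ecoef_neq0 h3] := eqVneq (ecoef i r.+2) 0.
    by rewrite !mulr0 mul0rn.
  move: hs; rewrite /sexp.
  case: (j.+1 =P i :> nat) => ?; case: (i.+1 =P j :> nat) => ?;
    case: (j.+1 =P n) => ?; lia.
Qed.

Lemma trmxX p (M : 'M[F]_p) m : M^T ^+ m = (M ^+ m)^T.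
Proof.
elim: m => [|m IH]; first by rewrite !expr0 trmx1.
by rewrite exprS exprSr IH !mxmulE trmx_mul.
Qed.

Lemma nat_sf i j a b : i != j -> (a + b)%N = absz (1 - cartan i j) ->
  H i ^+ a * H j * H i ^+ b = 0.
Proof.
move=> ij; rewrite addnC => ab.
rewrite !natgen_f !trmxX !mxmulE -!trmx_mul.
by have := nat_se ij ab; rewrite !mxmulE mulmxA => ->; rewrite trmx0.
Qed.

Lemma nat_ok r : Uq_rel q r -> ev natgen r = 0.
Proof.
apply: Uq_rel_ok; [exact: nat_kV | exact: nat_Vk | exact: nat_kk | exact: nat_ke
  | exact: nat_kf | exact: nat_ef | exact: nat_se | exact: nat_sf].
Qed.

(* The natural representation; q not a root of unity is what makes [natgen]
   respect the commutation relation of e_i and f_i. *)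
Definition natrep : {lrmorphism Uq n q -> 'M[F]_n.*2} :=
  HB.pack (plift natgen : Uq n q -> 'M[F]_n.*2)
    (GRing.isLinear.Build F (Uq n q) 'M[F]_n.*2 *:%R (plift natgen)
       (plift_linear nat_ok))
    (GRing.isMonoidMorphism.Build (Uq n q) 'M[F]_n.*2 (plift natgen)
       (plift_monoid nat_ok)).

Lemma natrep_e i : natrep (Ue q i) = natgen (Ge i).
Proof. exact: (plift_gen nat_ok). Qed.
Lemma natrep_f i : natrep (Uf q i) = natgen (Gf i).
Proof. exact: (plift_gen nat_ok). Qed.
Lemma natrep_k i : natrep (Uk q i) = natgen (Gk i).
Proof. exact: (plift_gen nat_ok). Qed.
Lemma natrep_kV i : natrep (UkV q i) = natgen (GkV i).
Proof. exact: (plift_gen nat_ok). Qed.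
End NatRep.

(* x lies in the unital subalgebra generated by X. *)
Definition subalg_gen (F : fieldType) (A : lalgType F) (X : A -> Prop) (x : A)
    : Prop :=
  forall S : {pred A}, GRing.subalg_closed S -> (forall z, X z -> z \in S) ->
  x \in S.

Arguments natrep {F n q} q0 qroot : simpl never.

Section Coideal.
Context (F : fieldType) (n : nat) (q : F) (y : 'I_n.*2 -> F).

(* The matrix A = sum_i y_i e_{ii'}. *)
Definition stabA : 'M[F]_n.*2 := \sum_i y i *: delta_mx i (rev_ord i).

Definition ccoef (i : 'I_n) : F :=
  if i.+1 == n then - (y (ix i) ^+ 2 * q ^+ n.*2)^-1
  else - q * (y (ixS i) / y (ix i)).

(* e_i + c_i F_i with F_i = q^{h_i} f_i. *)
Definition Xgen (i : 'I_n) : Uq n q := Ue q i + ccoef i *: (Uk q i * Uf q i).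

Definition in_Uqk : Uq n q -> Prop := subalg_gen (fun z => exists i, z = Xgen i).
End Coideal.

(* Main.v *)
Require Import Defs.
From mathcomp Require Import all_boot all_order all_algebra.
From mathcomp Require Import reals complex.
From mathcomp Require Import zify ring.
Import GRing.Theory.
Local Open Scope ring_scope.

(* The matrices commuting with A form a subalgebra, so it suffices to treat the
   generators X_{alpha_i}. Multiplication by A sends e_{jk} to y_k e_{jk'} on
   the right and to y_{j'} e_{j'k} on the left, so each generator reduces to a
   comparison of coefficients, which is decided by y_i y_{i'} being independent
   of i. *)

Lemma mul_delta_stabA (F : fieldType) (n : nat) (y : 'I_n.*2 -> F)
    (j k : 'I_n.*2) :
  delta_mx j k *m stabA y = y k *: delta_mx j (rev_ord k).
Proof.
rewrite /stabA mulmx_sumr (bigD1 k) //= big1 => [|i ik].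
  by rewrite -scalemxAr mul_delta_mx addr0.
by rewrite -scalemxAr mul_delta_mx_0 ?scaler0 // eq_sym.
Qed.

Lemma mul_stabA_delta (F : fieldType) (n : nat) (y : 'I_n.*2 -> F)
    (j k : 'I_n.*2) :
  stabA y *m delta_mx j k = y (rev_ord j) *: delta_mx (rev_ord j) k.
Proof.
rewrite /stabA mulmx_suml (bigD1 (rev_ord j)) //= big1 => [|i ij].
  by rewrite rev_ordK -scalemxAl mul_delta_mx addr0.
rewrite -scalemxAl mul_delta_mx_0 ?scaler0 //.
by apply: contra ij => /eqP <-; rewrite rev_ordK.
Qed.

Lemma mul_diag_delta (R : pzSemiRingType) (m : nat) (d : 'rV[R]_m)
    (j k : 'I_m) :
  diag_mx d *m delta_mx j k = d 0 j *: delta_mx j k.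
Proof.
apply/matrixP => r c; rewrite mul_diag_mx !mxE.
by case: (r =P j) => [->|_]; rewrite ?mulr0.
Qed.

(** The image of [f_i] is spanned by the basis vectors $i+1$ and $i'$, which have the same
    [q^{h_i}]-eigenvalue, so $F_i$ acts as a scalar multiple of $f_i$. *)
Lemma natgen_kf (F : fieldType) (n : nat) (q : F) (q0 : q != 0) (i : 'I_n) :
  natgen q (Gk i) *m natgen q (Gf i) =
  if i.+1 == n then q ^- 2 *: delta_mx (ixS i) (ix i)
  else q^-1 *: (delta_mx (ixS i) (ix i)
                - delta_mx (rev_ord (ix i)) (rev_ord (ixS i))).
Proof.
have hi := ltn_ord i; rewrite /=.
case: (i.+1 =P n) => hn; rewrite ?mulmxBr !mul_diag_delta !mxE !(wtE q0) /wtn /=.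
  rewrite hn eqxx.
  have -> : (n == i)%N = false by lia.
  by have -> : (n + n)%N == n.*2 by lia.
(* In each of the two weights exactly one indicator of [wtn] survives, with sign $-1$. *)
have -> : (i.+1 == n)%N = false by lia.
have -> : (i.+1 == i)%N = false by lia.
have -> : (i.+1 + i.+1 == n.*2)%N = false by lia.
have -> : (i.+1 + i.+2 == n.*2)%N = false by lia.
have -> : (n.*2 - i.+1 == i)%N = false by lia.
have -> : (n.*2 - i.+1 + i.+1 == n.*2)%N by lia.
have -> : (n.*2 - i.+1 == i.+1)%N = false by lia.
have -> : (n.*2 - i.+1 + i.+2 == n.*2)%N = false by lia.
by rewrite eqxx scalerBr.
Qed.

Lemma natrep_Xgen (F : fieldType) (n : nat) (q : F) (q0 : q != 0)
    (qroot : forall m : nat, (0 < m)%N -> ~~ m.-unity_root q)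
    (y : 'I_n.*2 -> F) (i : 'I_n) :
  natrep q0 qroot (Xgen q y i) =
  natgen q (Ge i) + ccoef q y i *: (natgen q (Gk i) *m natgen q (Gf i)).
Proof.
have -> : natrep q0 qroot (Xgen q y i) = natrep q0 qroot (Ue q i) +
    ccoef q y i *: (natrep q0 qroot (Uk q i) *m natrep q0 qroot (Uf q i)).
  by rewrite /Xgen addrC linearP rmorphM addrC.
by rewrite natrep_e natrep_k natrep_f.
Qed.

Lemma natrep_Xgen_stabA (F : fieldType) (n : nat) (q : F) (q0 : q != 0)
    (qroot : forall m : nat, (0 < m)%N -> ~~ m.-unity_root q)
    (y : 'I_n.*2 -> F)
    (hy : forall i : 'I_n.*2, y i * y (rev_ord i) = - q ^- (n.*2 + 2))
    (i : 'I_n) :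
  natrep q0 qroot (Xgen q y i) *m stabA y =
  stabA y *m natrep q0 qroot (Xgen q y i).
Proof.
(* The product $y_j y_{j'}$ is minus a power of $q$, hence nonzero. *)
have y0 j : y j != 0.
  apply/eqP => yj; have := hy j; rewrite yj mul0r => /esym/eqP.
  by rewrite oppr_eq0 invr_eq0 (negPf (expf_neq0 _ q0)).
rewrite natrep_Xgen natgen_kf // /ccoef /=; case: ifP => [/eqP hn|_].
  (* For the last root $n+1=n'$, so both products with $A$ are combinations of the diagonal units at
     $n$ and $n'$. *)
  have ixSE : ixS i = rev_ord (ix i) by apply: val_inj => /=; lia.
  rewrite mulmxDl mulmxDr -!scalemxAl -!scalemxAr.
  rewrite !mul_delta_stabA !mul_stabA_delta ixSE !rev_ordK.
  set c := - _.
  (* This is [hy] at $n$ divided by $y_n$: the value of $c_{\alpha_n}$ absorbs the factor $q^{-2}$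
     coming from $F_n$. It makes the two sides agree up to the order of summands. *)
  have -> : y (rev_ord (ix i)) = c * q ^- 2 * y (ix i).
    apply: (mulfI (y0 (ix i))); rewrite hy /c exprD.
    by field; rewrite ?expf_neq0 ?y0 ?q0.
  by rewrite !scalerA addrC.
set a := ix i; set b := ixS i.
rewrite mulmxDl mulmxDr -!scalemxAl -!scalemxAr !mulmxBl !mulmxBr.
rewrite !mul_delta_stabA !mul_stabA_delta !rev_ordK.
rewrite !scalerA; set c := _ * q^-1.
(* The factor $q$ in $c_{\alpha_i}$ cancels the $q^{-1}$ from $F_i$, leaving $c=-y_b/y_a$. Four
   matrix units occur on each side; their coefficients match by this identity and its mirror image
   [ya'], which follows from $y_ay_{a'}=y_by_{b'}$. *)
have yb : y b = - c * y a by rewrite /c; field; rewrite y0 q0.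
have ya' : y (rev_ord a) = - c * y (rev_ord b).
  have -> : - c = y b / y a by rewrite yb mulfK.
  apply: (mulfI (y0 a)); rewrite hy -(hy b).
  by field; rewrite y0.
move: c yb ya' => c -> ->.
rewrite !mulNr !scaleNr !scalerBr !scalerA !opprK.
by rewrite [LHS]addrC; congr (_ + _); apply: addrC.
Qed.

Lemma commuting_subalg_closed (F : fieldType) (A : lalgType F) (p : nat)
    (phi : {lrmorphism A -> 'M[F]_p}) (M : 'M[F]_p) :
  GRing.subalg_closed [pred x | phi x *m M == M *m phi x].
Proof.
split=> [|c u v|u v]; rewrite !inE.
- by rewrite rmorph1 mulmx1 mul1mx.
- move=> /eqP hu /eqP hv; rewrite linearP /= mulmxDl mulmxDr.
  by rewrite -scalemxAl -scalemxAr hu hv.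
- move=> /eqP hu /eqP hv; rewrite rmorphM mxmulE.
  by rewrite -mulmxA hv mulmxA hu mulmxA.
Qed.

Theorem mainTheorem5 (R : realType) (n : nat) (q : R[i])
    (q0 : q != 0) (qroot : forall m : nat, (0 < m)%N -> ~~ m.-unity_root q)
    (y : 'I_n.*2 -> R[i])
    (hy : forall i : 'I_n.*2, y i * y (rev_ord i) = - q ^- (n.*2 + 2)) :
  forall x : Uq n q, in_Uqk y x ->
    natrep q0 qroot x *m stabA y = stabA y *m natrep q0 qroot x.
Proof.
move=> x hx; apply/eqP.
(* [in_Uqk] means membership in every subalgebra containing the generators; it is used here for the
   preimage of the commutant of $A$. *)
apply: (hx _ (commuting_subalg_closed _ _ _ (natrep q0 qroot) (stabA y))).
by move=> _ [i ->]; rewrite inE; apply/eqP; apply: natrep_Xgen_stabA.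
Qed.
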